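(* Every graph $G$ has an $ec$-partition.
   Context: Graphs are finite and simple. Let $G=(V,E)$ be a graph. Two distinct edges are adjacent if they share an endpoint. A set $D\subseteq E$ is an edge-dominating set if every edge in $E\setminus D$ is adjacent to an edge of $D$. Two disjoint sets of edges $E_1,E_2$ form an edge coalition if neither $E_1$ nor $E_2$ is an edge-dominating set but $E_1\cup E_2$ is an edge-dominating set. An edge coalition partition ($ec$-partition) of $G$ is a partition $\pi=\{E_1,\ldots,E_k\}$ of $E$ into nonempty sets such that every $E_i$ is either a singleton (one-element) edge-dominating set, or is not an edge-dominating set but forms an edge coalition with another set $E_j$ of $\pi$. *)

(* Defs.v *)
From mathcomp Require Import all_boot.

Set Implicit Arguments.
Unset Strict Implicit.
Unset Printing Implicit Defensive.

(* A finite simple graph is a finite vertex type T with a symmetric and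
   irreflexive adjacency relation e : rel T; its edges are the unordered pairs
   {x, y} with e x y. The graph may have no vertices or no edges. *)

Section EdgeCoalitions.

Variables (T : finType) (e : rel T).

Implicit Types (f g : {set T}) (D E : {set {set T}}).

Definition edges : {set {set T}} :=
  [set f : {set T} | [exists x, exists y, e x y && (f == [set x; y])]].

Definition edge_adjacent f g : bool :=
  [&& f \in edges, g \in edges, f != g & [exists x, (x \in f) && (x \in g)]].

Definition edge_dominating D : bool :=
  (D \subset edges) &&
  [forall f in edges :\: D, exists g in D, edge_adjacent f g].

Definition edge_coalition E1 E2 : bool :=
  [&& E1 \subset edges, E2 \subset edges, [disjoint E1 & E2],
      ~~ edge_dominating E1, ~~ edge_dominating E2
    & edge_dominating (E1 :|: E2)].

(* [partition] already requires the blocks to be nonempty. For an edgeless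
   graph the empty family is the (only) partition of the edge set. *)
Definition ec_partition (P : {set {set {set T}}}) : bool :=
  partition P edges &&
  [forall A in P,
     ((#|A| == 1) && edge_dominating A)
     || (~~ edge_dominating A && [exists B in P :\ A, edge_coalition A B])].

End EdgeCoalitions.

(* Main.v *)
Require Import Defs.
From mathcomp Require Import all_boot.

(** Extend one non-dominating edge to a maximal non-dominating set [A] of edges,
    and let the partition consist of [A] and of all singletons outside [A].
    By maximality, adding any edge to [A] gives a dominating set; so every
    singleton outside [A] either dominates by itself or is a coalition partner
    of [A].  The set [A] has such a partner because it is not dominating: some
    edge [g] outside [A] is adjacent to no edge of [A], and since [A] is
    nonempty, [g] alone fails to dominate [A] ([undominated_not_dominating]).
    If every edge dominates by itself, the partition into singletons works; this
    includes the edgeless graph. *)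

Lemma partition_singletons (U : finType) (D : {set U}) :
  partition [set [set x] | x in D] D.
Proof.
apply/and3P; split.
- rewrite cover_imset; apply/eqP/setP=> x.
  apply/bigcupP/idP=> [[y yD /set1P->] // | xD].
  by exists x; rewrite ?set11.
- apply/trivIsetP=> _ _ /imsetP[x _ ->] /imsetP[y _ ->] neq.
  rewrite disjoints1 in_set1; apply: contraNneq neq => ->; exact: eqxx.
- apply/imsetP=> -[x _ eq0].
  by have := set11 x; rewrite -eq0 in_set0.
Qed.

Section Graph.

Variables (T : finType) (e : rel T).

Implicit Types (f g : {set T}) (A D : {set {set T}}).

Lemma edge_adjacent_sym f g : edge_adjacent e f g = edge_adjacent e g f.
Proof.
rewrite /edge_adjacent eq_sym andbCA; do 3![congr (_ && _)].
by apply: eq_existsb => x; rewrite andbC.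
Qed.

Lemma edge_dominatingPn D : D \subset edges e -> ~~ edge_dominating e D ->
  exists2 g, g \in edges e :\: D
           & forall f, f \in D -> ~~ edge_adjacent e g f.
Proof.
move=> sD; rewrite /edge_dominating sD => /forall_inPn[g gD].
by move=> /exists_inPn nadj; exists g.
Qed.

(** Edge adjacency being symmetric, an edge that is not dominated by a nonempty
    set [A] does not dominate any edge of [A] either. *)
Lemma undominated_not_dominating A f g : A \subset edges e -> f \in A ->
    g \notin A -> (forall h, h \in A -> ~~ edge_adjacent e g h) ->
  ~~ edge_dominating e [set g].
Proof.
move=> sA fA gA nadj; apply/negP=> /andP[_ /forall_inP/(_ f)].
rewrite in_setD in_set1 (subsetP sA) // andbT.
case: eqP => [fg | _ /(_ isT)]; first by rewrite -fg fA in gA.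
case/exists_inP=> h /set1P->; rewrite edge_adjacent_sym.
by apply/negP; apply: nadj.
Qed.

Lemma edge_coalition_sym A D : edge_coalition e A D = edge_coalition e D A.
Proof.
by rewrite /edge_coalition disjoint_sym setUC andbCA; do 3![congr (_ && _)];
   rewrite andbCA.
Qed.

Lemma ec_partition_singletons :
    (forall f, f \in edges e -> edge_dominating e [set f]) ->
  ec_partition e [set [set f] | f in edges e].
Proof.
move=> dom; rewrite /ec_partition partition_singletons.
apply/forall_inP=> _ /imsetP[f fE ->].
by rewrite cards1 eqxx dom.
Qed.

(** Maximality makes every non-dominating singleton outside [A] a coalition
    partner of [A]; an edge that [A] leaves undominated supplies one. *)
Lemma ec_partition_maximal A : A != set0 ->
    maxset (fun D => (D \subset edges e) && ~~ edge_dominating e D) A ->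
  ec_partition e (A |: [set [set f] | f in edges e :\: A]).
Proof.
move=> A0 /maxsetP[/andP[sA ndA] maxA].
have sgA f : f \notin A -> [set f] != A.
  by apply: contraNneq => <-; rewrite set11.
have coal f : f \in edges e :\: A -> ~~ edge_dominating e [set f] ->
    edge_coalition e A [set f].
  case/setDP=> fE fA ndf; apply/and5P; split=> //; first by rewrite sub1set.
    by rewrite disjoint_sym disjoints1.
  (* If the union did not dominate, maximality would give A :|: [set f] = A. *)
  rewrite ndf; apply: contraNT fA => ndAf.
  rewrite -(maxA (A :|: [set f])) ?subsetUl ?inE ?eqxx ?orbT //.
  by rewrite subUset sA sub1set fE.
apply/andP; split.
  rewrite -[X in partition _ X](setID _ A) (setIidPr sA).
  apply: partitionU1 => //; first exact: partition_singletons.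
  by rewrite disjoint_sym disjoints_subset subDset setUCr subsetT.
apply/forall_inP=> B /setU1P[-> | /imsetP[f fEA ->]].
- apply/orP; right; rewrite ndA.
  have [g gEA nadj] := edge_dominatingPn _ sA ndA.
  have [gE gA] := setDP gEA; have [f fA] := set0Pn _ A0.
  apply/exists_inP; exists [set g].
    by rewrite in_setD1 sgA // setU1r // imset_f.
  by apply: coal => //; exact: (undominated_not_dominating _ _ _ sA fA gA nadj).
- rewrite cards1 /=; case: (boolP (edge_dominating e [set f])) => //= ndf.
  have [_ fA] := setDP fEA.
  apply/exists_inP; exists A; last by rewrite edge_coalition_sym coal.
  by rewrite in_setD1 eq_sym sgA // setU11.
Qed.

End Graph.

Theorem mainTheorem1 (T : finType) (e : rel T)
  (e_sym : symmetric e) (e_irrefl : irreflexive e) :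
  exists P : {set {set {set T}}}, ec_partition e P.
Proof.
case: (boolP [forall f in edges e, edge_dominating e [set f]]).
  move/forall_inP=> dom; exists [set [set f] | f in edges e].
  exact: ec_partition_singletons.
case/forall_inPn=> f fE ndf.
have [|A maxA sfA] := @maxset_exists _
  (fun D => (D \subset edges e) && ~~ edge_dominating e D) [set f].
  by rewrite sub1set fE.
exists (A |: [set [set g] | g in edges e :\: A]).
apply: ec_partition_maximal maxA.
by apply/set0Pn; exists f; rewrite -sub1set.
Qed.
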